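(* Let $G$ be a connected graph with $|V(G)|$ odd. Then the following are equivalent: (1) $G$ is IPP-extremal; (2) $G$ is IndPP-extremal; (3) every block of $G$ is an odd complete graph (and in particular, $G$ is a block graph).
   Context: All graphs are finite, simple, and nonnull (at least one vertex). A graph is odd if it has an odd number of vertices. An induced path in $G$ is an induced subgraph of $G$ that is a path (possibly with only one vertex). An isometric path in $G$ is a path in $G$ that is of smallest possible length (number of edges) among all paths in $G$ between its two endpoints (one-vertex paths are isometric). An induced path partition (resp. isometric path partition) of $G$ is a collection of induced (resp. isometric) paths in $G$ whose vertex sets partition $V(G)$; the smallest cardinality of such a collection is denoted by $\text{indpp}(G)$ (resp. $\text{ipp}(G)$). The matching number $\nu(G)$ is the largest cardinality of a matching of $G$. $G$ is IPP-extremal if $\text{ipp}(G) = |V(G)|-\nu(G)$, and IndPP-extremal if $\text{indpp}(G) = |V(G)|-\nu(G)$. A cut-vertex of a graph $G$ on at least two vertices is a vertex $v$ such that $G \setminus v$ has more connected components than $G$. A graph is biconnected if it is connected and has no cut-vertices (so all complete graphs, including those on one and two vertices, are biconnected). A block of $G$ is a maximal biconnected induced subgraph of $G$. A block graph is a graph all of whose blocks are complete graphs. *)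

(* Defs.v *)
From HB Require Import structures.
From mathcomp Require Import all_boot.

Set Implicit Arguments.
Unset Strict Implicit.
Unset Printing Implicit Defensive.

Record sgraph := SGraph {
  vertex :> finType;
  adj : rel vertex;
  adj_sym : symmetric adj;
  adj_irr : irreflexive adj;
  sgraph_nonnull : 0 < #|vertex|
}.

Section Graphs.
Variable G : sgraph.
Implicit Types (x y v : G) (s p q : seq G) (A B M : {set G}).

(* Induced subgraphs are given by their vertex sets; [ind_adj A] is the
   adjacency of G[A], regarded as a relation on G. *)
Definition ind_adj A : rel G := [rel x y | [&& x \in A, y \in A & adj x y]].

Definition connected A : bool :=
  (A != set0) && [forall x in A, forall y in A, connect (ind_adj A) x y].

Definition ncomp A : nat := n_comp (ind_adj A) A.

Definition cut_vertex A v : bool :=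
  [&& 1 < #|A|, v \in A & ncomp A < ncomp (A :\ v)].

Definition biconnected A : bool :=
  connected A && [forall v, ~~ cut_vertex A v].

Definition block B : bool := maxset biconnected B.

Definition complete A : bool :=
  [forall x in A, forall y in A, (x != y) ==> adj x y].

(* A path x_0 - x_1 - ... - x_k is the nonempty sequence of its vertices. *)
Definition gpath s : bool :=
  if s is x :: p then path (@adj G) x p && uniq (x :: p) else false.

Definition induced_path s : bool :=
  gpath s &&
  [forall i : 'I_(size s), forall j : 'I_(size s),
     adj (tnth (in_tuple s) i) (tnth (in_tuple s) j)
       == ((i.+1 == j) || (j.+1 == i))].

(* The competing paths x :: q have distinct vertices, hence size q < #|G|:
   the bound on k is no restriction, see [isometric_pathP]. *)
Definition isometric_path s : bool :=
  gpath s &&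
  if s is x :: p then
    [forall k : 'I_#|G|, forall q : k.-tuple G,
       gpath (x :: q) && (last x q == last x p) ==> (size p <= size q)]
  else false.

Lemma isometric_pathP x p :
  reflect (gpath (x :: p) /\
           forall q, gpath (x :: q) -> last x q = last x p -> size p <= size q)
          (isometric_path (x :: p)).
Proof.
apply: (iffP andP) => -[Gp Hp]; split=> //.
  move=> q Gq lq; have /andP[_ /card_uniqP Uq] := Gq.
  have lt_q : size q < #|G| by rewrite -[(size q).+1]Uq max_card.
  move/forallP/(_ (Ordinal lt_q))/forallP/(_ (in_tuple q)): Hp.
  by rewrite Gq lq eqxx.
apply/forallP=> k; apply/forallP=> q; apply/implyP=> /andP[Gq /eqP lq].
exact: Hp.
Qed.

Definition spans (pathp : pred (seq G)) A : bool :=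
  [exists s : #|A|.-tuple G, pathp s && ([set x in s] == A)].

(* Collections of paths with disjoint vertex sets are represented by the
   collection of these vertex sets, which has the same cardinality. *)
Definition path_partition (pathp : pred (seq G)) (P : {set {set G}}) : bool :=
  partition P [set: G] && [forall A in P, spans pathp A].

Lemma ex_path_partition (pathp : pred (seq G)) :
  (forall x, pathp [:: x]) ->
  exists n, [exists P, path_partition pathp P && (#|P| == n)].
Proof.
move=> path1; pose P := [set [set x] | x : G].
exists #|P|; apply/existsP; exists P; rewrite eqxx andbT; apply/andP; split.
  apply/and3P; split.
  - apply/eqP/setP=> x; rewrite inE; apply/bigcupP.
    by exists [set x]; rewrite ?set11 ?imset_f.
  - apply/trivIsetP=> _ _ /imsetP[x _ ->] /imsetP[y _ ->] nxy.
    by rewrite disjoints1 inE; apply: contraNneq nxy => ->.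
  - by apply/imsetP=> -[x _ /setP/(_ x)]; rewrite !inE eqxx.
apply/forall_inP=> _ /imsetP[x _ ->]; apply/existsP.
have sz : size [:: x] == #|[set x]| by rewrite cards1.
exists (Tuple sz); rewrite path1 /=; apply/eqP/setP=> y.
by rewrite !inE.
Qed.

Lemma induced_path1 x : induced_path [:: x].
Proof.
by apply/andP; split=> //; apply/forallP=> i; apply/forallP=> j;
   rewrite !ord1 adj_irr.
Qed.

Lemma isometric_path1 x : isometric_path [:: x].
Proof. by apply/isometric_pathP. Qed.

Definition indpp : nat := ex_minn (ex_path_partition induced_path1).

Definition ipp : nat := ex_minn (ex_path_partition isometric_path1).

Definition edges : {set {set G}} :=
  [set [set xy.1; xy.2] | xy : G * G & adj xy.1 xy.2].

Definition matching (M : {set {set G}}) : bool :=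
  (M \subset edges) && trivIset M.

Definition matching_number : nat := \max_(M | matching M) #|M|.

Definition ipp_extremal : Prop := ipp = #|G| - matching_number.

Definition indpp_extremal : Prop := indpp = #|G| - matching_number.

End Graphs.

(* Main.v *)
Require Import Defs.
From mathcomp Require Import all_boot perm.
From mathcomp Require Import zify.

Set Implicit Arguments.
Unset Strict Implicit.
Unset Printing Implicit Defensive.

(** Isometric paths are induced, and the edges of a maximum matching together
    with the vertices it misses form an isometric path partition, so that always
    indpp <= ipp <= n - nu ([indpp_le_ipp], [ipp_le_sub_matching]). Hence
    IndPP-extremality implies IPP-extremality. The cycle is closed by deriving
    odd complete blocks from IPP-extremality, and IndPP-extremality from odd
    complete blocks. Both go through a local form of being a block graph,
    [locally_clique]: two neighbours of b that are connected in G - b are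
    adjacent or equal.

    From IPP-extremality to the blocks. A matching is encoded as an involution
    f, whose fixed points (holes) are the unmatched vertices. Let f be maximum,
    h a hole and v a neighbour of h. If v were a hole, or v were matched to some f v not adjacent
    to h, the path h, v, f v would be isometric and could replace the two parts
    {h} and {v, f v}; extremality forbids this. So h, v, f v is a triangle
    ([extremal_triangle]), and exchanging the edge {v, f v} for {h, f v} slides
    the hole from h to v. Sliding one hole towards another along a path leads to
    a contradiction, so there is at most one ([extremal_hole_uniq]) and, as n is
    odd, exactly one; by sliding it can be put anywhere.
    From then on only the triangle property of near-perfect matchings is used.
    If a and c are neighbours of b connected in G - b, slide the hole from b to
    a and then along a path to c that avoids b: the partner of b can be followed
    along the way, and the triangle property at c compares it with c
    ([walk_back]). This yields [locally_clique], hence complete blocks, and a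
    near-perfect matching with its hole in a block B matches the rest of B
    within B, so B is odd ([near_perfect_odd_block]).

    From the blocks to IndPP-extremality. Cycles are biconnected, so complete
    blocks give [locally_clique], and cliques are biconnected, so maximal
    cliques are odd.
    Root G at r and measure depth by the distance to r. By [locally_clique]
    every x <> r has a single neighbour closer to r, its parent; the neighbours
    of x at the same depth, with x, form a clique with the same parent; adding
    the parent makes a maximal clique. Hence these sibling classes, which
    partition G - r, are even. Matching each class within itself gives
    nu >= (n-1)/2. In an induced path partition, the vertices of a part whose
    parent is outside the part are siblings ([top_siblings]), so each part is
    charged to one class. At most one vertex of a class shares a part with the
    parent, a part takes at most two vertices of a class, and the class has even
    size 2k: so at least k parts are charged to it. With the part of r, there
    are at least (n+1)/2 parts ([induced_partition_lower]). *)

(** * Isometric paths, induced paths and path partitions *)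

Section Basics.
Variable G : sgraph.
Implicit Types (x y z : G) (s p q : seq G) (A B : {set G}).
Implicit Types (pathp : pred (seq G)) (P : {set {set G}}).

Lemma adj_neq x y : adj x y -> x != y.
Proof. by apply: contraTneq => ->; rewrite adj_irr. Qed.

Lemma connected_connect x y : connected [set: G] -> connect (@adj G) x y.
Proof.
case/andP=> _ /forall_inP Gc.
apply: (connect_sub _ (forall_inP (Gc x (in_setT x)) y (in_setT y))) => u v.
by case/and3P=> _ _; apply: connect1.
Qed.

Lemma spans_intro pathp s A :
  pathp s -> uniq s -> [set x in s] = A -> spans pathp A.
Proof.
move=> ps Us <-; apply/existsP.
have sz : size s == #|[set x in s]| by rewrite cardsE (card_uniqP Us).
by exists (Tuple sz); rewrite ps /= eqxx.
Qed.

Lemma spans_elim pathp A :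
  spans pathp A -> exists2 s : seq G, pathp s & A = [set x in s].
Proof. by case/existsP=> s /andP[ps /eqP <-]; exists s. Qed.

Lemma isometric_edge x y : adj x y -> isometric_path [:: x; y].
Proof.
move=> xy; apply/isometric_pathP; split=> [|[|z q] //= _ yx].
  by rewrite /= xy inE adj_neq.
by rewrite yx adj_irr in xy.
Qed.

Lemma isometric_P3 x y z :
  adj x y -> adj y z -> x != z -> ~~ adj x z -> isometric_path [:: x; y; z].
Proof.
move=> xy yz nxz Nxz; apply/isometric_pathP; split=> [|[|u [|w q]] //=].
- by rewrite /= xy yz !inE negb_or nxz !adj_neq.
- by move=> _ xz; rewrite xz eqxx in nxz.
- by rewrite andbT => /andP[xu _] uz; rewrite -uz xu in Nxz.
Qed.

(** A chord between positions i and j.+1 of x :: p (the latter is position j of p)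
    lets one skip the vertices strictly between them. *)
Lemma gpath_shortcut x p i j :
  gpath (x :: p) -> i <= j -> j < size p ->
  adj (nth x (x :: p) i) (nth x p j) ->
  let q := take i p ++ drop j p in
  gpath (x :: q) /\ last x q = last x p.
Proof.
move=> /andP[xp] Up le_ij lt_j adj_ij q.
have def_p : take j p ++ nth x p j :: drop j.+1 p = p.
  by rewrite -drop_nth // cat_take_drop.
have lasti : last x (take i p) = nth x (x :: p) i.
  rewrite (last_nth x) size_takel; last by lia.
  by rewrite -[x :: take i p]/(take i.+1 (x :: p)) nth_take.
have sub_q : subseq (x :: q) (x :: p).
  rewrite /= eqxx -[X in subseq _ X](cat_take_drop j) cat_subseq //.
  by rewrite -(take_takel p le_ij) take_subseq.
split; last by rewrite -[in RHS]def_p /q (drop_nth x lt_j) !last_cat.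
apply/andP; split; last exact: subseq_uniq sub_q Up.
rewrite /q (drop_nth x lt_j) cat_path take_path //= lasti adj_ij /=.
by move: xp; rewrite -[in X in X -> _]def_p cat_path /= => /and3P[].
Qed.

(** A chord would give a shortcut. *)
Lemma isometric_induced s : isometric_path s -> induced_path s.
Proof.
case: s => // x p /isometric_pathP[gp minp].
have far i j : i < j -> j < size (x :: p) ->
    adj (nth x (x :: p) i) (nth x (x :: p) j) = (i.+1 == j).
  case: j => // j lt_ij lt_j; rewrite eqSS.
  case: eqP => [eq_ij | /eqP nij].
    by have /andP[/(pathP x) xp _] := gp; rewrite -eq_ij in lt_j *; exact: xp i lt_j.
  have lt_jp : j < size p := lt_j.
  apply/negP=> adj_ij; have [gq lq] := gpath_shortcut (j := j) gp lt_ij lt_j adj_ij.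
  have := minp _ gq lq; rewrite size_cat size_drop size_takel; last by lia.
  by lia.
rewrite /induced_path gp; apply/forallP=> i; apply/forallP=> j.
rewrite !(tnth_nth x); apply/eqP.
case: (ltngtP i j) => [lt_ij | lt_ji | eq_ij].
- by rewrite far //; lia.
- by rewrite adj_sym far //; lia.
- by rewrite eq_ij adj_irr; lia.
Qed.

Lemma spans_isometric_induced A :
  spans (@isometric_path G) A -> spans (@induced_path G) A.
Proof.
by case/existsP=> s /andP[/isometric_induced ps sA]; apply/existsP; exists s; rewrite ps.
Qed.

Lemma ipp_le P : path_partition (@isometric_path G) P -> ipp G <= #|P|.
Proof.
rewrite /ipp => PP; case: ex_minnP => n _; apply.
by apply/existsP; exists P; rewrite PP /=.
Qed.

Lemma indpp_attained :
  exists2 P, path_partition (@induced_path G) P & #|P| = indpp G.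
Proof.
rewrite /indpp; case: ex_minnP => n /existsP[P /andP[PP /eqP <-]] _.
by exists P.
Qed.

Lemma indpp_le_ipp : indpp G <= ipp G.
Proof.
rewrite /ipp; case: ex_minnP => n /existsP[P /andP[/andP[PP PA] /eqP <-]] _.
rewrite /indpp; case: ex_minnP => m _; apply; apply/existsP; exists P.
rewrite eqxx andbT /path_partition PP; apply/forall_inP=> A AP.
exact: spans_isometric_induced (forall_inP PA A AP).
Qed.

(** The exchange argument behind extremality: in a smallest partition, no two
    parts have a union that is again spanned by an admissible path. *)
Lemma path_partition_merge pathp P A B :
    path_partition pathp P -> A \in P -> B \in P -> A != B ->
    spans pathp (A :|: B) ->
  exists2 Q, path_partition pathp Q & #|Q| < #|P|.
Proof.
case/andP=> partP PP AP BP nAB sAB; pose R := P :\ A :\ B.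
have BPA : B \in P :\ A by rewrite !inE eq_sym nAB.
have := partitionD1 (partitionD1 partP AP) BPA; rewrite -/R => partR.
exists ((A :|: B) |: R).
  apply/andP; split.
    rewrite -(setUCr (A :|: B)) -setTD -setDDl; apply: partitionU1 partR _ _.
      have := partition_neq0 partP AP.
      by apply: contraNneq => /eqP; rewrite setU_eq0 => /andP[].
    by rewrite -setI_eq0 setDDl setDE setICA setICr setI0.
  apply/forall_inP=> C /setU1P[-> // | CR]; apply: (forall_inP PP).
  by move: CR; rewrite !inE => /and3P[].
rewrite cardsU1 (cardsD1 A P) (cardsD1 B (P :\ A)) AP BPA -/R.
by case: (_ \notin R) => /=; move: #|R| => k; lia.
Qed.

End Basics.

(** * Matchings as involutions *)

Section Pairings.
Variable G : sgraph.
Implicit Types (x y v h : G) (s p q : seq G) (A B M : {set G}) (f : G -> G).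

(** A matching, seen as the map sending a matched vertex to its partner and
    fixing the unmatched ones. *)
Definition pairing f := involutive f /\ forall x, f x != x -> adj x (f x).

Definition holes f : {set G} := [set x | f x == x].

Definition pairs f : {set {set G}} := [set [set x; f x] | x : G].

Lemma pairs_eq f x z :
  involutive f -> z \in [set x; f x] -> [set z; f z] = [set x; f x].
Proof. by move=> fK /set2P[] -> //; rewrite fK setUC. Qed.

Lemma pairs_partition f : involutive f -> partition (pairs f) [set: G].
Proof.
move=> fK; apply/and3P; split.
- apply/eqP/setP=> x; rewrite inE; apply/bigcupP.
  by exists [set x; f x]; rewrite ?set21 //; apply: imset_f.
- apply/trivIsetP=> _ _ /imsetP[x _ ->] /imsetP[y _ ->].
  apply: contraNT => /pred0Pn[z /andP[zx zy]].
  by rewrite -(pairs_eq fK zx) (pairs_eq fK zy).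
- by apply/imsetP=> -[x _ /setP/(_ x)]; rewrite !inE eqxx.
Qed.

(** Count each orbit twice: an orbit {x, f x} contributes its size, plus one when
    it is a single hole. *)
Lemma card_pairs f : involutive f -> (#|pairs f|).*2 = #|G| + #|holes f|.
Proof.
move=> fK; have PP := pairs_partition fK.
have -> : #|G| + #|holes f| = \sum_(x in [set: G]) (1 + (f x == x)).
  rewrite big_split /= sum1_card cardsT; congr addn.
  rewrite -sum1_card big_mkcond [RHS]big_mkcond; apply: eq_bigr => x _.
  by rewrite !inE; case: eqP.
rewrite (set_partition_big _ PP) -muln2 -sum_nat_const /=.
apply: eq_bigr => _ /imsetP[x _ ->].
have [fx | nfx] := eqVneq (f x) x; first by rewrite fx setUid big_set1 fx eqxx.
by rewrite big_setU1 ?inE 1?eq_sym // big_set1 fK [x == _]eq_sym (negbTE nfx).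
Qed.

Lemma pairs_path_partition f :
  pairing f -> path_partition (@isometric_path G) (pairs f).
Proof.
case=> fK f_adj; apply/andP; split; first exact: pairs_partition.
apply/forall_inP=> _ /imsetP[x _ ->].
have [fx | nfx] := eqVneq (f x) x.
  apply: (spans_intro (isometric_path1 x)) => //.
  by apply/setP=> y; rewrite fx setUid !inE.
have xfx := f_adj x nfx; apply: (spans_intro (isometric_edge xfx)).
  by rewrite /= inE eq_sym nfx.
by apply/setP=> y; rewrite !inE.
Qed.

Lemma card_cover_matching (M : {set {set G}}) : matching M -> #|cover M| = (#|M|).*2.
Proof.
case/andP=> /subsetP ME tM; rewrite -muln2 -sum_nat_const.
have /eqP <- := tM; apply: eq_bigr => A /ME /imsetP[[x y]].
by rewrite inE => /adj_neq nxy ->; rewrite cards2 nxy.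
Qed.

(** The two-element orbits of f form a matching that covers all but the holes. *)
Lemma pairing_le_matching f : pairing f -> #|G| <= (matching_number G).*2 + #|holes f|.
Proof.
case=> fK f_adj; pose M := [set A in pairs f | #|A| == 2].
have PP := pairs_partition fK.
have Mm : matching M.
  apply/andP; split; last first.
    by apply: trivIsetS (partition_trivIset PP); apply/subsetP=> A; rewrite inE => /andP[].
  apply/subsetP=> A; rewrite inE => /andP[/imsetP[x _ ->]]; rewrite cards2 => nfx.
  apply/imsetP; exists (x, f x) => //; rewrite inE /= f_adj // eq_sym.
  by case: (x != f x) nfx.
have covM : ~: holes f \subset cover M.
  apply/subsetP=> x; rewrite !inE => nfx; apply/bigcupP; exists [set x; f x]; last exact: set21.
  by rewrite inE cards2 [x == _]eq_sym nfx andbT; apply: imset_f.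
have leM : #|M| <= matching_number G by rewrite /matching_number (bigmax_sup M).
have := subset_leq_card covM; rewrite (card_cover_matching Mm) cardsCs setCK.
by move: leM; have := max_card (holes f); lia.
Qed.

(** The pairing of a maximum matching: 2 nu vertices are matched. The inequality
    from left to right holds for every pairing, by [pairing_le_matching]. *)
Definition optimal f := pairing f /\ #|G| = (matching_number G).*2 + #|holes f|.

Lemma optimal_exists : exists f, optimal f.
Proof.
rewrite /optimal /matching_number.
have [|M Mm ->] := @eq_bigmax_cond _ (@matching G) (fun M : {set {set G}} => #|M|).
  apply/card_gt0P; exists set0; apply/andP; split; first exact: sub0set.
  by apply/trivIsetP=> A B; rewrite inE.
have /andP[/subsetP ME /trivIsetP tM] := Mm.
pose f x := if [pick y | [set x; y] \in M] is Some y then y else x.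
have edgeM x y : [set x; y] \in M -> adj x y.
  move=> xyM; have /imsetP[[u v]] := ME _ xyM; rewrite inE /= => uv E.
  have nuv := adj_neq uv.
  have : u \in [set x; y] by rewrite E set21.
  have : v \in [set x; y] by rewrite E set22.
  move=> /set2P[] Ev /set2P[] Eu; subst u v; rewrite ?eqxx // in nuv *.
  by rewrite adj_sym.
have fE x y : [set x; y] \in M -> f x = y.
  rewrite /f => xyM; case: pickP => [z xzM | /(_ y)]; last by rewrite xyM.
  apply/eqP; apply: contraT => nzy.
  have nE : [set x; z] != [set x; y].
    apply: contra nzy => /eqP/setP/(_ z); rewrite !inE eqxx orbT => /esym/orP[]// /eqP zx.
    by have := edgeM _ _ xzM; rewrite zx adj_irr.
  by have /pred0P/(_ x) := tM _ _ xzM xyM nE; rewrite /= !set21.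
have fM x : f x != x -> [set x; f x] \in M.
  by rewrite {1}/f; case: pickP => [y xyM _| _]; [rewrite (fE _ _ xyM) | rewrite eqxx].
exists f; split; first split.
- move=> x; have [fx | nfx] := eqVneq (f x) x; first by rewrite !fx.
  by apply: fE; rewrite setUC; exact: fM.
- by move=> x nfx; apply: edgeM (fM x nfx).
rewrite -(card_cover_matching Mm) -(cardsC (cover M)).
congr addn; apply: eq_card => x; rewrite !inE.
apply/idP/eqP => [xNM | fx].
  apply/eqP; apply: contraNT xNM => nfx; apply/bigcupP.
  by exists [set x; f x]; [exact: fM | exact: set21].
apply/bigcupP=> -[A AM xA]; have /imsetP[[u v]] := ME _ AM.
rewrite inE /= => /adj_neq nuv E; subst A; case/set2P: xA => E; subst x.
  by rewrite (fE _ _ AM) in fx; rewrite fx eqxx in nuv.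
by rewrite setUC in AM; rewrite (fE _ _ AM) in fx; rewrite fx eqxx in nuv.
Qed.

Lemma ipp_le_sub_matching : ipp G <= #|G| - matching_number G.
Proof.
have [f [pf cG]] := optimal_exists; have [fK _] := pf.
by have := ipp_le (pairs_path_partition pf); have := card_pairs fK; lia.
Qed.

End Pairings.

(** * Sliding a hole of a maximum matching *)

Section Slide.
Variable G : sgraph.
Implicit Types (x y v h : G) (s p q : seq G) (A B M : {set G}) (f : G -> G).

(** The conjugate of f by the transposition of h and v. When h is a hole, v
    becomes a hole and h takes over the former partner of v. Being a conjugate,
    it is involutive and has as many holes as f for free. *)
Definition slide f h v : G -> G := fun x => tperm h v (f (tperm h v x)).

Lemma slideR f h v : f h = h -> slide f h v v = v.
Proof. by move=> fh; rewrite /slide tpermR fh tpermL. Qed.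

Lemma slideL f h v : f h = h -> f v != v -> involutive f -> slide f h v h = f v.
Proof.
move=> fh nfv fK; rewrite /slide tpermL tpermD //; last by rewrite eq_sym.
apply: contraNneq nfv => hfv; have -> : v = h by rewrite -[v]fK -hfv fh.
by rewrite fh.
Qed.

Lemma slideD f h v x :
  x != h -> x != v -> f x != h -> f x != v -> slide f h v x = f x.
Proof. by move=> xh xv fxh fxv; rewrite /slide !tpermD // eq_sym. Qed.

Lemma slide_holes f h v x : (slide f h v x == x) = (f (tperm h v x) == tperm h v x).
Proof. by rewrite /slide -{2}(tpermK h v x) (inj_eq perm_inj). Qed.

Lemma slide_pairing f h v :
    pairing f -> f h = h -> adj h (f v) -> pairing (slide f h v).
Proof.
case=> fK f_adj fh hfv; have fvh : f v != h by rewrite eq_sym adj_neq.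
split=> [x | x]; first by rewrite /slide tpermK fK tpermK.
rewrite slide_holes /slide; case: tpermP => [->|->|/eqP nxh /eqP nxv] nfx.
- by rewrite tpermD // eq_sym.
- by rewrite fh eqxx in nfx.
case: tpermP => [fxh|fxv|_ _]; last exact: f_adj.
  by rewrite -[x]fK fxh fh eqxx in nxh.
by rewrite -[x]fK fxv adj_sym.
Qed.

Lemma card_slide_holes f h v : #|holes (slide f h v)| = #|holes f|.
Proof.
rewrite -(card_imset (holes f) (@perm_inj _ (tperm h v))); apply: eq_card => x.
rewrite inE slide_holes; apply/idP/imsetP=> [fx | [y + ->]].
  by exists (tperm h v x); rewrite ?inE // tpermK.
by rewrite inE tpermK.
Qed.

Hypothesis ext : ipp_extremal G.

(** Otherwise h, v, f v (or h, v, when v is a hole) is an isometric path, and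
    merging the parts {h} and {v, f v} beats n - nu. *)
Lemma extremal_triangle f h v :
  optimal f -> f h = h -> adj h v -> f v != v /\ adj h (f v).
Proof.
move=> [pf cardG] fh hv; have [fK f_adj] := pf.
have nhv := adj_neq hv.
suff no_merge : ~~ spans (@isometric_path G) ([set h; f h] :|: [set v; f v]).
  have nfv : f v != v.
    apply: contra no_merge => /eqP fv; rewrite fh fv !setUid.
    apply: (spans_intro (isometric_edge hv)); first by rewrite /= inE nhv.
    by apply/setP=> y; rewrite !inE.
  split=> //; apply: contraR no_merge => Nhfv; rewrite fh setUid.
  have nhfv : h != f v by apply: contraNneq nhv => E; rewrite -[v]fK -E fh.
  have vfv := f_adj v nfv.
  apply: (spans_intro (isometric_P3 hv vfv nhfv Nhfv)).
    by rewrite /= !inE negb_or nhv nhfv eq_sym nfv.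
  by apply/setP=> y; rewrite !inE orbA.
(* Merging leaves fewer than n - nu isometric paths. *)
apply/negP=> sp; have PP := pairs_path_partition pf.
have [|||Q PQ ltQ] := path_partition_merge PP _ _ _ sp; try exact: imset_f.
  by apply: contra nhv => /eqP/setP/(_ v); rewrite fh !inE eqxx /= orbb eq_sym.
have := ipp_le PQ; have := card_pairs fK; move: ext; rewrite /ipp_extremal; lia.
Qed.

(** Slide h along a path towards the hole h'. The latter stays a hole until the
    moving hole becomes adjacent to it, against [extremal_triangle]. *)
Lemma extremal_hole_uniq f h h' :
  connect (@adj G) h h' -> optimal f -> f h = h -> f h' = h' -> h = h'.
Proof.
move=> /connectP[p]; elim: p f h => [|v p IHp] f h /= => [_ -> // | /andP[hv vp] lp].
move=> of_ fh fh'; have [fv hfv] := extremal_triangle of_ fh hv.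
have [pf cG] := of_; have [fK _] := pf.
apply/eqP; apply: contraNT fv => nhh'.
have [-> | nvh'] := eqVneq v h'; first by rewrite fh'.
case/eqP: (nvh'); apply: (IHp (slide f h v)) => //.
- by split; [exact: slide_pairing | rewrite card_slide_holes].
- exact: slideR.
- by rewrite slideD ?fh' // eq_sym.
Qed.

End Slide.

(** * Near-perfect matchings with the triangle property *)

Section NearPerfect.
Variable G : sgraph.
Implicit Types (x y v h : G) (s p q : seq G) (A B M : {set G}) (f : G -> G).

Definition near_perfect f h := pairing f /\ forall x, (f x == x) = (x == h).

(** The trace of extremality from which the structure of the blocks is derived.
    It makes every slide of the hole along an edge legal ([slide_near]). *)
Definition triangle_closed :=
  forall f h v, near_perfect f h -> adj h v -> adj h (f v).

Lemma near_perfect_holes f h : near_perfect f h -> holes f = [set h].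
Proof. by case=> _ fE; apply/setP=> x; rewrite !inE fE. Qed.

Lemma extremal_triangle_closed :
    connected [set: G] -> odd #|G| -> ipp_extremal G ->
  triangle_closed /\ exists f h, near_perfect f h.
Proof.
move=> Gc Godd ext; have [f opt] := optimal_exists G; have [pf cG] := opt.
have /odd_gt0 : odd #|holes f| by move: Godd; rewrite cG oddD odd_double.
case/card_gt0P=> h; rewrite inE => /eqP fh.
have fE x : (f x == x) = (x == h).
  apply/eqP/eqP=> [fx | ->//].
  exact: extremal_hole_uniq ext _ _ _ (connected_connect x h Gc) opt fx fh.
have npf : near_perfect f h by [].
split; last by exists f, h.
move=> f' h' v npf' hv; have [pf' fE'] := npf'.
have fh' : f' h' = h' by apply/eqP; rewrite fE'.
apply: (extremal_triangle ext _ fh' hv).2.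
by split=> //; rewrite cG (near_perfect_holes npf) (near_perfect_holes npf') !cards1.
Qed.

Hypothesis Gtri : triangle_closed.

Lemma near_perfect_hole f h : near_perfect f h -> f h = h.
Proof. by case=> _ fE; apply/eqP; rewrite fE. Qed.

Lemma near_perfectN f h v : near_perfect f h -> v != h -> f v != v.
Proof. by case=> _ ->. Qed.

Lemma slide_near f h v : near_perfect f h -> adj h v -> near_perfect (slide f h v) v.
Proof.
move=> npf hv; have [pf fE] := npf; have fh := near_perfect_hole npf.
split; first exact: slide_pairing (Gtri npf hv).
by move=> x; rewrite slide_holes fE -(inj_eq (@perm_inj _ (tperm h v))) tpermK tpermL.
Qed.

Lemma slideLn f h v : near_perfect f h -> adj h v -> slide f h v h = f v.
Proof.
move=> npf hv; have [[fK _] fE] := npf; apply: slideL => //.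
  exact: near_perfect_hole npf.
by apply: near_perfectN npf _; rewrite eq_sym adj_neq.
Qed.

Lemma slideDn f h v x :
  near_perfect f h -> x != h -> x != v -> x != f v -> slide f h v x = f x.
Proof.
move=> npf xh xv xfv; have [[fK _] _] := npf; have fh := near_perfect_hole npf.
apply: slideD => //; first by apply: contraNneq xh => E; rewrite -[x]fK E fh.
by apply: contraNneq xfv => <-; rewrite fK.
Qed.

Lemma near_perfect_hole_everywhere f h :
  connected [set: G] -> near_perfect f h -> forall x, exists g, near_perfect g x.
Proof.
move=> Gc + x; have /connectP[p] := connected_connect h x Gc.
elim: p f h => [|v p IHp] f h /=; first by move=> _ -> ?; exists f.
by case/andP=> hv vp lp npf; apply: IHp vp lp (slide_near npf hv).
Qed.

(** For x <> b, slide the hole from b to y: the pair x, f x is not affected, and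
    the triangle property at y turns the edge from x into one from f x. *)
Lemma edge_spread f b x y :
  near_perfect f b -> adj b y -> adj x y -> y != f x -> adj (f x) y.
Proof.
move=> npf byy xy nyfx; have [[fK _] fE] := npf.
have [xb | nxb] := eqVneq x b; first by rewrite xb (near_perfect_hole npf).
have npf' := slide_near npf byy.
have nxy := adj_neq xy.
have := Gtri npf' (v := x); rewrite adj_sym => /(_ xy).
rewrite (slideDn npf) //; first by rewrite adj_sym.
by apply: contraNneq nyfx => ->; rewrite fK.
Qed.

(** If no two of a, d, c are matched, [edge_spread] at b joins f d to both a and c.
    Sliding the hole from b to a and then to f d matches a with d, and
    [edge_spread] at the hole f d carries the edge from d to c over to a. *)
Lemma nbr_trans f b a d c :
    near_perfect f b -> adj b a -> adj b d -> adj b c ->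
  adj a d -> adj d c -> a != c -> adj a c.
Proof.
move=> npf ba bd bc ad dc nac; have [[fK f_adj] fE] := npf.
have [E | nda] := eqVneq d (f a).
  by rewrite -[a]fK -E; apply: edge_spread npf bc dc _; rewrite E fK eq_sym.
have [E | ncd] := eqVneq c (f d).
  rewrite adj_sym E; apply: edge_spread npf ba _ _; first by rewrite adj_sym.
  by rewrite -E.
have [E | nca] := eqVneq c (f a).
  by rewrite E f_adj // (near_perfectN npf) // eq_sym adj_neq.
have d'c : adj (f d) c by apply: edge_spread npf bc dc _.
have npf1 := slide_near npf ba.
have nab := adj_neq ba; have ndb := adj_neq bd.
have nad := adj_neq ad.
have ad' : adj a (f d).
  rewrite adj_sym; apply: edge_spread npf ba _ _; first by rewrite adj_sym.
  by apply: contraNneq nda => ->; rewrite fK.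
(* The hole is now at f d, and a is matched with d. *)
have npf2 := slide_near npf1 ad'.
have f1d : slide f b a d = f d.
  by rewrite (slideDn npf) // eq_sym.
have f2a : slide (slide f b a) a (f d) a = d.
  by rewrite (slideLn npf1) // -f1d; have [[-> _] _] := npf1.
have [[f2K _] _] := npf2; have f2d := esym (canRL f2K f2a).
by rewrite -f2d; apply: edge_spread npf2 d'c dc _; rewrite f2d eq_sym.
Qed.

Definition avoid b : rel G := ind_adj (~: [set b]).

(** The hole travels along x :: p, which avoids b, and b keeps its partner a' as
    long as the path does not visit a'. When the hole has arrived at a neighbour
    of b, the triangle property makes it adjacent to a'. If the next vertex is
    a' itself, sliding there makes the current vertex x the partner of b; as x and
    a' are adjacent neighbours of b, [nbr_trans] converts the conclusion about
    x into the one about a'. *)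
Lemma walk_back f b x p a' :
    near_perfect f x -> f b = a' -> b != x -> path (avoid b) x p ->
    adj b (last x p) ->
    (forall h, exists f', near_perfect f' h) ->
  last x p = a' \/ adj a' (last x p).
Proof.
move=> + + + + + ex_np; elim: p f x a' => [|y p IHp] f x a' npf fb nbx /= xp bc.
  by right; rewrite adj_sym -fb; apply: Gtri npf _; rewrite adj_sym.
case/andP: xp => /and3P[_]; rewrite !inE => nyb xy yp.
have [[fK f_adj] fE] := npf; have npf' := slide_near npf xy.
have nby : b != y by rewrite eq_sym.
have ba' : adj b a' by rewrite -fb f_adj // fE.
have [E | nya'] := eqVneq y a'; last first.
  have nbfy : b != f y by apply: contraNneq nya' => E; rewrite -fb E fK.
  by apply: (IHp _ _ _ npf' _ nby yp bc); rewrite (slideDn npf).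
subst y; have fa' : f a' = b by rewrite -fb fK.
have bx : adj b x by rewrite adj_sym -fa'; apply: Gtri npf xy.
have f'b : slide f x a' b = x.
  have [[f'K _] _] := npf'; apply: esym (canRL f'K _).
  by rewrite (slideLn npf).
have [f' npfb] := ex_np b.
have [->|nc] := eqVneq (last a' p) a'; [by left | right].
have [E|xc] := IHp _ _ x npf' f'b nby yp bc; first by rewrite E adj_sym.
by apply: nbr_trans npfb ba' bx bc _ xc _; rewrite 1?adj_sym 1?eq_sym.
Qed.

(** Local form of being a block graph: the neighbours of b in one component of
    G - b form a clique. *)
Definition locally_clique := forall a b c,
  adj b a -> adj b c -> a != c -> connect (avoid b) a c -> adj a c.

(** Take the hole at b and slide it to a, so that b is matched with the former
    partner f a of a; [walk_back] compares c with f a, and [nbr_trans] concludes. *)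
Lemma near_perfect_locally_clique :
  (forall h, exists f', near_perfect f' h) -> locally_clique.
Proof.
move=> ex_np a b c ba bc nac /connectP[p ap lc]; subst c.
have [f npf] := ex_np b; have [[fK f_adj] fE] := npf.
have npf' := slide_near npf ba.
have nab : a != b by rewrite eq_sym adj_neq.
have ba' := Gtri npf ba; have aa' : adj a (f a) by rewrite f_adj ?fE.
have nba : b != a by rewrite eq_sym.
have [-> //|a'c] := walk_back npf' (slideLn npf ba) nba ap bc ex_np.
exact: nbr_trans npf ba ba' bc aa' a'c nac.
Qed.

End NearPerfect.

(** * Biconnected sets and blocks *)

Section Blocks.
Variable G : sgraph.
Implicit Types (x y z v h : G) (s p q : seq G) (A B M S : {set G}) (f : G -> G).

Lemma ind_connect_sym A : connect_sym (ind_adj A).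
Proof.
by apply: sym_connect_sym => x y; rewrite /ind_adj /= adj_sym andbCA.
Qed.

Lemma connect_in S x q :
  path (@adj G) x q -> {subset x :: q <= S} -> connect (ind_adj S) x (last x q).
Proof.
elim: q x => [|y q IHq] x /=; first by rewrite connect0.
case/andP=> xy yq sub; apply: (@connect_trans _ _ y).
  by apply: connect1; rewrite /ind_adj /= xy !sub ?inE ?eqxx ?orbT.
by apply: IHq yq _ => z zq; apply: sub; rewrite inE zq orbT.
Qed.

Lemma connect_in_sub A B x y :
  A \subset B -> connect (ind_adj A) x y -> connect (ind_adj B) x y.
Proof.
move=> /subsetP sAB; apply: connect_sub => u v /and3P[uA vA uv]; apply: connect1.
by rewrite /ind_adj /= !sAB.
Qed.

Lemma ncomp_le1 A :
  ncomp A <= 1 <-> {in A &, forall x y, connect (ind_adj A) x y}.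
Proof.
have clA : closed (ind_adj A) A by move=> x y /and3P[-> ->].
have symA := ind_connect_sym A.
split=> [/card_le1_eqP le1 x y xA yA | conn].
  have rA z : z \in A -> root (ind_adj A) z \in [predI roots (ind_adj A) & A].
    move=> zA; apply/andP; split; first exact: roots_root.
    by have := closed_connect clA (connect_root _ z); rewrite zA.
  by apply/(rootP symA); apply: le1; apply: rA.
apply/card_le1_eqP=> x y; rewrite !inE => /andP[/eqP rx xA] /andP[/eqP ry yA].
by rewrite -rx -ry; apply/(rootP symA)/conn.
Qed.

Lemma ncomp_gt0 A : A != set0 -> 0 < ncomp A.
Proof.
case/set0Pn=> x xA; have clA : closed (ind_adj A) A by move=> u v /and3P[-> ->].
apply/card_gt0P; exists (root (ind_adj A) x); apply/andP; split.
  by apply: roots_root; apply: ind_connect_sym.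
by have := closed_connect clA (connect_root _ x); rewrite xA.
Qed.

(** For a connected set the component counts in the definition of cut vertices
    amount to staying connected after the removal of any vertex. *)
Lemma biconnectedP A :
  reflect [/\ A != set0, {in A &, forall x y, connect (ind_adj A) x y} &
            forall v, v \in A -> {in A :\ v &, forall x y, connect (ind_adj (A :\ v)) x y}]
          (biconnected A).
Proof.
apply: (iffP andP) => [[/andP[A0 /forall_inP cA] /forallP noc] | [A0 cA cAv]].
  have {}cA : {in A &, forall x y, connect (ind_adj A) x y}.
    by move=> x y xA yA; apply: (forall_inP (cA x xA)).
  split=> // v vA x y xA; apply: (iffLR (ncomp_le1 (A :\ v))) xA.
  have := noc v; rewrite /cut_vertex vA /= negb_and -leqNgt -leqNgt.
  case/orP=> [A1 | /leq_trans]; last by apply; apply/ncomp_le1.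
  apply/ncomp_le1=> u w /setD1P[nuv uA].
  by rewrite (card_le1_eqP A1 u v uA vA) eqxx in nuv.
split; first apply/andP; first split=> //.
  by apply/forall_inP=> x xA; apply/forall_inP=> y; apply: cA.
apply/forallP=> v; apply/negP=> /and3P[_ vA]; rewrite ltnNge; case/negP.
by apply: leq_trans (ncomp_gt0 A0); apply/ncomp_le1/cAv.
Qed.

Lemma completeP A :
  reflect {in A &, forall x y, x != y -> adj x y} (complete A).
Proof.
apply: (iffP forall_inP) => [cA x y xA yA nxy | cA x xA].
  by have /forall_inP/(_ y yA)/implyP := cA x xA; apply.
by apply/forall_inP=> y yA; apply/implyP; apply: cA.
Qed.

Lemma complete_connect A : complete A -> {in A &, forall x y, connect (ind_adj A) x y}.
Proof.
move=> /completeP cA x y xA yA; have [-> | nxy] := eqVneq x y; first exact: connect0.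
by apply: connect1; rewrite /ind_adj /= xA yA cA.
Qed.

Lemma complete_sub A B : A \subset B -> complete B -> complete A.
Proof. by move=> /subsetP sAB /completeP cB; apply/completeP=> x y /sAB xB /sAB; apply: cB. Qed.

Lemma complete_biconnected A : A != set0 -> complete A -> biconnected A.
Proof.
move=> A0 cA; apply/biconnectedP; split=> //; first exact: complete_connect.
by move=> v vA; apply: complete_connect; apply: complete_sub cA; apply: subsetDl.
Qed.

(** A block is a maximal clique as soon as it is a clique, since cliques are
    biconnected. *)
Lemma block_absorb B y : block B -> complete (y |: B) -> y \in B.
Proof.
move=> mB cyB; have /maxsetsup/(_ _ (subsetUr [set y] B)) := mB.
move=> <-; first exact: setU11.
by apply: complete_biconnected => //; apply/set0Pn; exists y; exact: setU11.
Qed.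

(** When v <> b is removed, every remaining vertex still reaches b along one of
    the two arcs of the cycle b, a, p. *)
Lemma cycle_biconnected b a p :
    path (avoid b) a p -> uniq (a :: p) -> adj b a -> adj b (last a p) ->
  biconnected (b |: [set x in a :: p]).
Proof.
move=> ap Up ba bl; set A := b |: _.
have ap' : path (@adj G) a p by apply: sub_path ap => x y /and3P[].
have bNp : b \notin a :: p.
  rewrite inE negb_or adj_neq //=.
  elim: p {Up bl A ap'} a {ba} ap => //= y p IHp a /andP[/and3P[_]].
  by rewrite !inE eq_sym negb_or => -> _ /IHp.
have memA z : z \in A = (z == b) || (z \in a :: p) by rewrite !inE.
have toA z : z \in A -> connect (ind_adj A) b z.
  rewrite memA => /orP[/eqP-> // | zp]; case/splitPl: zp @A ap' memA => p1 p2 <- A.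
  rewrite cat_path => /andP[ap1 _] memA.
  apply: (@connect_in _ b (a :: p1)); first by rewrite /= ba.
  move=> u; rewrite inE memA => /orP[->//|]; rewrite !inE mem_cat.
  by case/orP=> ->; rewrite ?orbT.
have from S z : {in S, forall u, connect (ind_adj S) z u} ->
    {in S &, forall u w, connect (ind_adj S) u w}.
  move=> zS u w /zS zu /zS; apply: connect_trans.
  by rewrite ind_connect_sym.
apply/biconnectedP; split=> [||v].
- by apply/set0Pn; exists b; rewrite memA eqxx.
- exact: from toA.
have [-> _ | nvb vA] := eqVneq v b.
  have {}memA z : (z \in A :\ b) = (z \in a :: p).
    rewrite in_setD1 memA; case: eqP => // ->; exact/esym/negbTE.
  apply: (from _ a) => z; rewrite memA => zp.
  case/splitPl: zp @A ap' memA {toA bl Up ap bNp} => p1 p2 <- A.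
  rewrite cat_path => /andP[ap1 _] memA.
  by apply: connect_in => // u u1; rewrite memA -cat_cons mem_cat u1.
apply: (from _ b) => z /setD1P[nzv]; rewrite memA => /orP[/eqP-> // | zp].
case/splitPl: zp @A ap' Up bl memA nzv vA {ap toA bNp} => p1 p2 <- A.
rewrite cat_path -cat_cons cat_uniq last_cat => /andP[ap1 p2p] /and3P[_ U12 _] bl memA nzv vA.
have [v1 | Nv1] := boolP (v \in a :: p1).
  rewrite ind_connect_sym -[b](last_rcons (last a p1) p2 b).
  apply: connect_in; first by rewrite rcons_path p2p adj_sym.
  move=> u; rewrite in_cons mem_rcons in_cons in_setD1 memA mem_cat.
  case/or3P=> [/eqP->|/eqP->|u2].
  - by apply/andP; split=> //; apply/or3P; apply: Or32; exact: mem_last.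
  - by rewrite [b == v]eq_sym nvb eqxx.
  rewrite u2 !orbT andbT; apply: contraNneq U12 => E; apply/hasP; exists u => //.
  by rewrite E.
apply: (@connect_in _ b (a :: p1)); first by rewrite /= ba.
move=> u; rewrite in_cons in_setD1 memA mem_cat => /orP[/eqP-> | u1].
  by rewrite [b == v]eq_sym nvb eqxx.
by rewrite u1 orbT andbT; apply: contraNneq Nv1 => <-.
Qed.

(** A path from a to c in G - b closes up through b into a cycle, which lies in
    one block. *)
Lemma complete_blocks_locally_clique :
  (forall B, block B -> complete B) -> locally_clique G.
Proof.
move=> cB b a c ba bc nac /connectP[q aq lc]; subst c.
case/shortenP: aq bc nac => p ap Up _ bc nac.
have bA := cycle_biconnected ap Up ba bc; have [B mB sAB] := maxset_exists bA.
apply: (completeP _ (complete_sub sAB (cB B mB))) => //.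
  by rewrite !inE eqxx orbT.
by apply/setUP; right; rewrite in_set; exact: mem_last.
Qed.

(** Along a path from x in B, adjacency to x propagates: if x is adjacent to y and
    y to z, then x and z are connected in B - y because y is not a cut vertex. *)
Lemma locally_clique_biconnected B :
  locally_clique G -> biconnected B -> complete B.
Proof.
move=> GK /biconnectedP[_ cB cBv]; apply/completeP=> x y xB yB nxy.
have /connectP[p xp ly] := cB x y xB yB; subst y.
elim/last_ind: p xp yB nxy => [|p z IHp] /=; first by rewrite eqxx.
rewrite last_rcons rcons_path => /andP[xp /= /and3P[yB _ yz]] zB nxz.
move: IHp yB yz; set y := last x p => IHp yB yz.
have [-> // | nxy] := eqVneq x y.
have xy := IHp xp yB nxy; apply: (GK x y z) => //; first by rewrite adj_sym.
apply: (@connect_in_sub (B :\ y)); first by rewrite setDE subsetIr.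
by apply: (cBv y yB); rewrite !inE ?xB ?zB ?nxy // eq_sym adj_neq.
Qed.

(** Extend f by the identity outside S and apply [card_pairs]. *)
Lemma even_involution f S :
  involutive f -> {in S, forall x, (f x \in S) && (f x != x)} -> ~~ odd #|S|.
Proof.
move=> fK fS; pose g x := if x \in S then f x else x.
have gK : involutive g.
  move=> x; rewrite /g; case: (boolP (x \in S)) => [xS | /negbTE-> //].
  by have /andP[-> _] := fS x xS; rewrite fK.
have gS : holes g = ~: S.
  apply/setP=> x; rewrite !inE /g; case: ifP => [/fS/andP[_ /negbTE] //|_].
  exact: eqxx.
have := card_pairs gK; rewrite gS -(cardsC S) => /(congr1 odd).
by rewrite odd_double -addnA addnn oddD odd_double addbF => <-.
Qed.

(** Put the hole at b in B. For x in B - b, the partner f x is adjacent to b and x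
    by the triangle property, and to the rest of B by [edge_spread]; so f x is in
    B by maximality, and B - b is matched within itself. *)
Lemma near_perfect_odd_block B :
  triangle_closed G -> (forall h, exists f, @near_perfect G f h) -> 
  block B -> complete B -> odd #|B|.
Proof.
move=> Gtri ex_np mB cB; have /completeP cBP := cB.
have /set0Pn[b bB] : B != set0 by have /maxsetp/biconnectedP[] := mB.
have [f npf] := ex_np b; have [[fK f_adj] fE] := npf.
rewrite (cardsD1 b) bB oddD /=; apply: (even_involution fK) => x /setD1P[nxb xB].
have bx : adj b x by rewrite cBP // eq_sym.
have bfx := Gtri _ _ _ npf bx; rewrite fE nxb andbT in_setD1 eq_sym adj_neq //=.
apply: block_absorb mB _; apply/completeP.
suff fxB y : y \in B -> f x != y -> adj (f x) y.
  move=> u w /setU1P[->|uB] /setU1P[->|wB]; rewrite ?eqxx //.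
  - exact: fxB.
  - by rewrite adj_sym eq_sym; apply: fxB.
  - exact: cBP.
move=> yB nfxy; have [-> | nyb] := eqVneq y b; first by rewrite adj_sym.
have [-> | nyx] := eqVneq y x; first by rewrite adj_sym f_adj // fE.
apply: (edge_spread Gtri npf); first by rewrite cBP // eq_sym.
  by rewrite cBP // eq_sym.
by rewrite eq_sym.
Qed.

End Blocks.

(** * Sets spanned by an induced path *)

Section InducedSpans.
Variable G : sgraph.
Implicit Types (x y z v h : G) (s p q : seq G) (A B M S : {set G}) (f : G -> G).

Lemma spans_induced_connect A :
  spans (@induced_path G) A -> {in A &, forall x y, connect (ind_adj A) x y}.
Proof.
case/spans_elim=> -[|a p] /andP[/= gs _] -> //; have /andP[ap _] := gs.
have froma x : x \in [set x in a :: p] -> connect (ind_adj [set x in a :: p]) a x.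
  rewrite in_set => xp; case/splitPl: xp ap => p1 p2 <-; rewrite cat_path => /andP[ap1 _].
  by apply: connect_in => // u u1; rewrite in_set -cat_cons mem_cat u1.
move=> x y xA yA. apply: connect_trans _ (froma y yA).
by rewrite ind_connect_sym froma.
Qed.

(** The positions of three pairwise adjacent vertices would be pairwise
    consecutive. *)
Lemma spans_induced_clique A B :
  spans (@induced_path G) A -> B \subset A -> complete B -> #|B| <= 2.
Proof.
case/spans_elim=> s /andP[gs /forallP ind] -> /subsetP sBA /completeP cB.
rewrite leqNgt; apply/negP=> /card_gt2P[x [y [z [[xB yB zB] [nxy nyz nzx]]]]].
have pos u w : u \in B -> w \in B -> u != w ->
    ((index u s).+1 == index w s) || ((index w s).+1 == index u s).
  move=> uB wB nuw; have us := sBA u uB; have ws := sBA w wB; rewrite !in_set in us ws.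
  rewrite -index_mem in us; rewrite -index_mem in ws.
  have /forallP/(_ (Ordinal ws)) := ind (Ordinal us).
  rewrite !(tnth_nth u) /= !nth_index -?index_mem // cB //.
have := pos x y xB yB nxy; have := pos y z yB zB nyz; have := pos z x zB xB nzx.
by lia.
Qed.

End InducedSpans.

Lemma depth_exists (G : sgraph) (r : G) :
    (forall x, connect (@adj G) r x) ->
  exists d : G -> nat,
    [/\ d r = 0, forall x y, adj x y -> d y <= (d x).+1 &
        forall x, x != r -> exists2 y, adj x y & d x = (d y).+1].
Proof.
move=> conn; pose reach x k := [exists q : k.-tuple G, path (@adj G) r q && (last r q == x)].
have reachI q : path (@adj G) r q -> reach (last r q) (size q).
  by move=> rq; apply/existsP; exists (in_tuple q); rewrite /= rq eqxx.
have reachE x k : reach x k -> exists2 q, path (@adj G) r q & last r q = x /\ size q = k.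
  by case/existsP=> q /andP[rq /eqP <-]; exists q; rewrite ?size_tuple.
have ex_reach x : exists k, reach x k.
  by have /connectP[q rq ->] := conn x; exists (size q); apply: reachI.
exists (fun x => ex_minn (ex_reach x)); split=> [|x y xy|x nxr].
- by case: ex_minnP => k _ /(_ 0 (reachI [::] isT)); rewrite leqn0 => /eqP.
- case: ex_minnP => k _ mink; case: ex_minnP => m /reachE[q rq [lq <-]] _.
  have := reachI (rcons q y); rewrite rcons_path rq lq xy last_rcons size_rcons.
  by move=> /(_ isT)/mink.
case: ex_minnP => k /reachE[q + [+ szq]] mink; case/lastP: q szq => [|q y].
  by move=> _ _ /= E; rewrite E eqxx in nxr.
rewrite size_rcons rcons_path last_rcons => szq /andP[rq ly] yx; subst y k.
exists (last r q); first by rewrite adj_sym.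
apply/eqP; rewrite eqSS eqn_leq; apply/andP; split; last first.
  by case: ex_minnP => m _; apply; apply: reachI.
case: ex_minnP => m /reachE[q' rq' [lq' <-]] _.
have := reachI (rcons q' x); rewrite rcons_path rq' lq' ly last_rcons size_rcons.
by move=> /(_ isT)/mink.
Qed.

(** * The rooted structure of a connected block graph *)

Section Rooted.
Variable G : sgraph.
Implicit Types (x y z v h : G) (s p q : seq G) (A B F M S : {set G}) (f : G -> G).
Variables (r : G) (d : G -> nat).
Hypothesis d_root : d r = 0.
Hypothesis d_adj : forall x y, adj x y -> d y <= (d x).+1.
Hypothesis d_up : forall x, x != r -> exists2 y, adj x y & d x = (d y).+1.
Hypothesis GK : locally_clique G.

(** Going up from x, the depth decreases, so g is never met. *)
Lemma connect_root_avoid g x : x != g -> d x <= d g -> connect (avoid g) x r.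
Proof.
have [k] := ubnP (d x); elim: k x => // k IHk x lt_k nxg le_xg.
have [-> | nxr] := eqVneq x r; first exact: connect0.
have [y xy dx] := d_up nxr; have nyg : y != g by apply: contraTneq le_xg => <-; rewrite dx; lia.
apply: (@connect_trans _ _ y); last by apply: IHk => //; lia.
by apply: connect1; rewrite /avoid /ind_adj /= !inE nxg nyg.
Qed.

Lemma connect_avoid g x y :
  x != g -> d x <= d g -> y != g -> d y <= d g -> connect (avoid g) x y.
Proof.
move=> xg dxg yg dyg; apply: connect_trans (connect_root_avoid xg dxg) _.
by rewrite ind_connect_sym connect_root_avoid.
Qed.

Lemma depth_gt0 x : x != r -> 0 < d x.
Proof. by case/d_up=> y _ ->. Qed.

(** Two upper neighbours y and z of x are adjacent by [locally_clique]. Then so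
    are z and an upper neighbour w of y, and then x and w, which are two levels
    apart. *)
Lemma up_unique x y z : adj x y -> adj x z -> d x = (d y).+1 -> d x = (d z).+1 -> y = z.
Proof.
move=> xy xz dy dz; apply/eqP/negPn/negP=> nyz.
have nyr : y != r.
  apply: contraNneq nyz => yr; rewrite yr d_root in dy; apply/eqP/esym.
  by rewrite yr; apply/eqP/negPn/negP=> /depth_gt0; lia.
have yz : adj y z.
  by apply: (GK xy xz nyz); apply: connect_avoid; rewrite 1?eq_sym ?adj_neq //; lia.
have [w yw dyw] := d_up nyr.
have nwz : w != z by apply: contra_eqN dz => /eqP <-; lia.
have nzy : z != y by rewrite eq_sym.
have wz : adj w z.
  by apply: (GK yw yz nwz); apply: connect_avoid; rewrite 1?eq_sym ?adj_neq //; lia.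
have nxw : x != w by apply: contra_eqN dy => /eqP ->; lia.
have yx : adj y x by rewrite adj_sym.
have xw : adj x w.
  apply: (GK yx yw nxw); apply: (@connect_trans _ _ z); apply: connect1.
    by rewrite /avoid /ind_adj /= !inE (adj_neq xy) nzy xz.
  by rewrite /avoid /ind_adj /= !inE nzy eq_sym (adj_neq yw) adj_sym wz.
by rewrite adj_sym in xw; have := d_adj xw; lia.
Qed.

Definition parent x := odflt x [pick y | adj x y && (d x == (d y).+1)].

Lemma parentP x : x != r -> adj x (parent x) /\ d x = (d (parent x)).+1.
Proof.
case/d_up=> y xy dx; rewrite /parent; case: pickP => [z /andP[-> /eqP] //|/(_ y)].
by rewrite xy dx eqxx.
Qed.

Lemma parentE x y : adj x y -> d x = (d y).+1 -> parent x = y.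
Proof.
move=> xy dx; have nxr : x != r by apply: contra_eqN dx => /eqP->; rewrite d_root.
by have [xp dp] := parentP nxr; apply: up_unique xp xy dp dx.
Qed.

(** In G - x, the parent of x and y are both connected to the root, hence they are
    adjacent. *)
Lemma sibling_parent x y : adj x y -> d x = d y -> parent x = parent y.
Proof.
move=> xy dxy; have nxr : x != r.
  apply: contraTneq xy => xr; rewrite xr d_root in dxy; rewrite xr.
  by have [->|/depth_gt0] := eqVneq y r; [rewrite adj_irr | lia].
have [xp dp] := parentP nxr; apply/esym/parentE; last by rewrite -dxy.
have npy : parent x != y by apply: contra_eqN dp => /eqP ->; rewrite dxy; lia.
rewrite adj_sym; apply: (GK xp xy npy).
by apply: connect_avoid; rewrite 1?eq_sym ?adj_neq //; lia.
Qed.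

Definition siblings x : {set G} := [set y | (y == x) || adj x y && (d y == d x)].

Lemma siblings_depth x y : y \in siblings x -> d y = d x.
Proof. by rewrite inE => /orP[/eqP->|/andP[_ /eqP]]. Qed.

Lemma siblings_parent x y : y \in siblings x -> parent y = parent x.
Proof.
rewrite inE => /orP[/eqP->//|/andP[xy /eqP dxy]].
by rewrite (sibling_parent xy).
Qed.

(** Siblings of x are connected in G - x through the parent of x. *)
Lemma siblings_complete x : complete (siblings x).
Proof.
have sib y z : adj x y -> adj x z -> d y = d x -> d z = d x -> y != z -> adj y z.
  move=> xy xz dy dz nyz; have nxr : x != r.
    apply: contraTneq xy => xr; rewrite xr d_root in dy; rewrite xr.
    by have [->|/depth_gt0] := eqVneq y r; [rewrite adj_irr | lia].
  have [xp dp] := parentP nxr.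
  have npx := adj_neq xp.
  have up u : adj x u -> d u = d x -> avoid x u (parent x).
    move=> xu du; have nur : u != r by apply: contra_eqN dp => /eqP ur; rewrite -du ur d_root.
    rewrite /avoid /ind_adj /= !inE [u == x]eq_sym (adj_neq xu) eq_sym npx /=.
    by rewrite (sibling_parent xu (esym du)); have [] := parentP nur.
  apply: (GK xy xz nyz); apply: (@connect_trans _ _ (parent x)).
    by apply: connect1; apply: up.
  by rewrite ind_connect_sym; apply: connect1; apply: up.
apply/completeP=> y z; rewrite !inE.
case/orP=> [/eqP-> | /andP[xy /eqP dy]] /orP[/eqP-> | /andP[xz /eqP dz]] //.
- by rewrite eqxx.
- by rewrite adj_sym.
- exact: sib.
Qed.

Lemma mem_siblings x : x \in siblings x. Proof. by rewrite inE eqxx. Qed.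

Lemma siblings_sym x y : y \in siblings x -> x \in siblings y.
Proof.
move=> yx; have [-> | nyx] := eqVneq y x; first exact: mem_siblings.
rewrite inE (siblings_depth yx) eqxx andbT orbC.
by rewrite (completeP _ (siblings_complete x)) ?mem_siblings.
Qed.

Lemma siblings_eq x y : y \in siblings x -> siblings y = siblings x.
Proof.
suff sub u v : v \in siblings u -> siblings v \subset siblings u.
  by move=> yx; apply/eqP; rewrite eqEsubset !sub // siblings_sym.
move=> vu; apply/subsetP=> w wv; have uv := siblings_sym vu.
have [-> | nwu] := eqVneq w u; first exact: mem_siblings.
rewrite inE (siblings_depth wv) (siblings_depth vu) eqxx andbT orbC.
by rewrite (completeP _ (siblings_complete v)) // eq_sym.
Qed.

Lemma siblings_root : siblings r = [set r].
Proof.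
apply/setP=> y; rewrite !inE; have [// | nyr] := eqVneq y r.
by rewrite d_root (gtn_eqF (depth_gt0 nyr)) andbF.
Qed.

Lemma parent_notin_siblings x : x != r -> parent x \notin siblings x.
Proof. by move=> /parentP[_ dx]; apply/negP=> /siblings_depth; lia. Qed.

Lemma parent_siblings_complete x : x != r -> complete (parent x |: siblings x).
Proof.
move=> nxr; have sibp y : y \in siblings x -> adj y (parent x).
  move=> yx; rewrite -(siblings_parent yx).
  have nyr : y != r by apply: contraTneq (depth_gt0 nxr) => yr; rewrite -(siblings_depth yx) yr d_root.
  by have [] := parentP nyr.
apply/completeP=> y z /setU1P[->|yx] /setU1P[->|zx]; rewrite ?eqxx //.
- by move=> _; rewrite adj_sym sibp.
- by move=> _; apply: sibp.
- exact: (completeP _ (siblings_complete x)).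
Qed.

Hypothesis odd_max_clique :
  forall B, B != set0 -> complete B -> (forall y, complete (y |: B) -> y \in B) -> odd #|B|.

(** The class of x with its parent is a maximal clique: a further vertex adjacent
    to both x and its parent is at the depth of one of them, so it is a sibling
    of x or a second parent. *)
Lemma siblings_even x : x != r -> ~~ odd #|siblings x|.
Proof.
move=> nxr; suff : odd #|parent x |: siblings x| by rewrite cardsU1 parent_notin_siblings.
apply: odd_max_clique.
- by apply/set0Pn; exists x; rewrite inE mem_siblings orbT.
- exact: parent_siblings_complete.
move=> y /completeP cy; set B := parent x |: siblings x in cy *.
have xB : x \in B by rewrite inE mem_siblings orbT.
have pB : parent x \in B by rewrite setU11.
have [//|yNB] := boolP (y \in B).
have toB z : z \in B -> adj y z.
  move=> zB; apply: cy; [exact: setU11 | by rewrite setU1r |].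
  by apply: contraNneq yNB => ->.
have [xp dp] := parentP nxr.
have yx := toB x xB; have yp := toB _ pB.
have dyx := d_adj yx; have py : adj (parent x) y by rewrite adj_sym.
have dpy := d_adj py; have xy : adj x y by rewrite adj_sym.
have [E | dyx'] := eqVneq (d y) (d x).
  by case/negP: yNB; apply/setUP; right; rewrite inE xy E eqxx orbT.
by case/negP: yNB; apply/setUP; left; rewrite inE (@parentE x y) //; lia.
Qed.

(** Elements of ranks 2i and 2i+1 in the enumeration of each class are
    exchanged; [enum] depends only on the class as a set, so this is
    an involution. *)
Definition mate x : G :=
  let s := enum (siblings x) in let i := index x s in
  nth x s (if odd i then i.-1 else i.+1).

Lemma mate_root : mate r = r.
Proof. by rewrite /mate siblings_root enum_set1 /= eqxx. Qed.

Lemma mate_spec x : x != r -> [/\ mate x \in siblings x, mate x != x & mate (mate x) = x].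
Proof.
move=> nxr; pose s := enum (siblings x); pose i := index x s.
pose j k := if odd k then k.-1 else k.+1.
have xs : x \in s by rewrite mem_enum mem_siblings.
have lt_i : i < size s by rewrite index_mem.
have ev : ~~ odd (size s) by rewrite -cardE siblings_even.
have lt_j : j i < size s by rewrite /j; case: ifP; lia.
have mxE : mate x = nth x s (j i) by [].
have ms : mate x \in siblings x by rewrite -mem_enum mxE mem_nth.
have idx : index (mate x) s = j i by rewrite mxE index_uniq ?enum_uniq.
split=> //.
  apply: contraTneq lt_i => E; move: idx; rewrite E -/i /j; case: ifP; lia.
rewrite {1}/mate (siblings_eq ms) -/s idx -/(j (j i)).
have -> : j (j i) = i by rewrite /j; case: (boolP (odd i)) => oi; case: ifP; lia.
by rewrite (set_nth_default x) // nth_index.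
Qed.

Lemma mate_near_perfect : near_perfect mate r.
Proof.
split; first split.
- move=> x; have [-> | /mate_spec[] //] := eqVneq x r; by rewrite !mate_root.
- move=> x; have [-> | nxr] := eqVneq x r; first by rewrite mate_root eqxx.
  have [mx _ _] := mate_spec nxr; rewrite eq_sym => nxm.
  by apply: (completeP _ (siblings_complete x)) => //; apply: mem_siblings.
move=> x; have [-> | nxr] := eqVneq x r; first by rewrite mate_root eqxx.
by apply/negbTE; have [] := mate_spec nxr.
Qed.

(** In a part A of a path partition, the vertices at which A cannot be continued
    towards the root. *)
Definition is_top A x := (x \in A) && ((x == r) || (parent x \notin A)).

Lemma top_exists A : A != set0 -> exists x, is_top A x.
Proof.
case/set0Pn=> x0 x0A; case: (arg_minnP d x0A) => x xA minx; exists x.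
have {}xA : x \in A := xA; rewrite /is_top xA /=; have [// | nxr] := eqVneq x r.
have [_ dx] := parentP nxr.
by apply/negP=> /minx; rewrite dx ltnn.
Qed.

(** Let d x <= d y and let g be the parent of y, so that A lives in G - g. If g is
    also the parent of x, then [locally_clique] at g makes x and y adjacent.
    Otherwise x reaches the root in G - g, hence so does y; then y is adjacent to
    the parent of g, which is two levels above it. *)
Lemma top_siblings A x y :
    {in A &, forall u v, connect (ind_adj A) u v} ->
  is_top A x -> is_top A y -> y \in siblings x.
Proof.
move=> cA tx ty.
wlog le_xy : x y tx ty / d x <= d y.
  by move=> W; have [/W|/ltnW/W] := leqP (d x) (d y); [apply | move=> W'; apply/siblings_sym/W'].
have /andP[xA tx'] := tx; have /andP[yA ty'] := ty.
have [yr | nyr] := eqVneq y r.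
  have [-> | nxr] := eqVneq x y; first exact: mem_siblings.
  by rewrite yr in nxr le_xy; have := depth_gt0 nxr; rewrite d_root in le_xy; lia.
rewrite (negbTE nyr) /= in ty'; set g := parent y in ty'.
have [yg dy] := parentP nyr; rewrite -/g in yg dy; clearbody g.
have nxg : x != g by apply: contraNneq ty' => <-.
have [-> | nyx] := eqVneq y x; first exact: mem_siblings.
have cyx : connect (avoid g) x y.
  apply: connect_in_sub (cA x y xA yA); apply/subsetP=> u uA; rewrite !inE.
  by apply: contraNneq ty' => <-.
have gy : adj g y by rewrite adj_sym.
have [/andP[nxr /eqP pxg] | Npxg] := boolP ((x != r) && (parent x == g)).
  have [xg dx] := parentP nxr; rewrite pxg in xg dx.
  have xy : adj x y by apply: (GK (b := g)) => //; [rewrite adj_sym | rewrite eq_sym].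
  by rewrite inE xy dy dx eqxx orbT.
have pxg : x != r -> parent x != g by move=> nxr; move: Npxg; rewrite nxr.
have ngr : g != r.
  apply/eqP=> gr; rewrite gr in nxg; have [_ dx] := parentP nxg.
  have := pxg nxg; rewrite gr => /depth_gt0 dpx.
  by rewrite gr d_root in dy; move: le_xy; rewrite dy dx ltnS leqNgt dpx.
have cxr : connect (avoid g) x r.
  have [|lt_gx] := leqP (d x) (d g); first exact: connect_root_avoid.
  have nxr : x != r by apply: contraTneq lt_gx => ->; rewrite d_root.
  have [xp dx] := parentP nxr; apply: (@connect_trans _ _ (parent x)).
    by apply: connect1; rewrite /avoid /ind_adj /= !inE nxg pxg.
  by apply: connect_root_avoid (pxg nxr) _; rewrite dx dy ltnS in le_xy.
have [gw dg] := parentP ngr; set w := parent g in gw dg; clearbody w.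
have nwg : w != g by rewrite eq_sym adj_neq.
have cwr : connect (avoid g) w r by apply: connect_root_avoid => //; rewrite dg.
have nyw : y != w by apply: contra_eqN dy => /eqP ->; rewrite dg ltn_eqF.
have yw : adj y w.
  apply: (GK gy gw nyw).
  apply: (@connect_trans _ _ x); first by rewrite ind_connect_sym.
  by apply: connect_trans cxr _; rewrite ind_connect_sym.
by rewrite adj_sym in yw; have := d_adj yw; rewrite dy dg ltnn.
Qed.

(** Both sides are summed over the sibling classes, each part being charged to
    the class of its tops. The class {r} accounts for the strict inequality. *)
Lemma induced_partition_lower (P : {set {set G}}) :
  path_partition (@induced_path G) P -> #|G| < (#|P|).*2.
Proof.
case/andP=> PP /forall_inP Pind.
have spansP x : spans (@induced_path G) (pblock P x).
  by apply: Pind; rewrite pblock_mem // (cover_partition PP).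
have trP := partition_trivIset PP.
have memP x : x \in pblock P x by rewrite mem_pblock (cover_partition PP).
have inP x : pblock P x \in P by rewrite pblock_mem // (cover_partition PP).
pose top A := odflt r [pick x | is_top A x].
have topP A : A \in P -> is_top A (top A).
  move=> AP; rewrite /top; case: pickP => // no.
  by have [x] := top_exists (partition_neq0 PP AP); rewrite no.
pose C := [set siblings x | x : G].
have sibC x : siblings x \in C by exact: imset_f.
have topE A x : A \in P -> is_top A x -> siblings (top A) = siblings x.
  move=> AP tx; apply/esym/siblings_eq.
  exact: top_siblings (spans_induced_connect (Pind A AP)) (topP A AP) tx.
rewrite -muln2 -sum_nat_const (partition_big (siblings \o top) (mem C)) /=;
  last by move=> A _; apply: sibC.
have -> : #|G| = \sum_(F in C) #|F|.
  rewrite -cardsT -sum1_card (partition_big siblings (mem C)) /=;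
    last by move=> x _; apply: sibC.
  apply: eq_bigr => _ /imsetP[x _ ->]; rewrite sum1dep_card; apply: eq_card => y.
  by rewrite inE in_setT; apply/eqP/idP=> [<- | yx]; [exact: mem_siblings | exact: siblings_eq].
rewrite (bigD1 (siblings r)) //= [X in _ < X](bigD1 (siblings r)) //= -addSn.
pose m F := #|[set A in P | siblings (top A) == F]|.
have mE F : \sum_(A in P | siblings (top A) == F) 2 = m F * 2.
  by rewrite -sum_nat_const; apply: eq_bigl => A; rewrite !inE.
apply: leq_add.
  rewrite mE siblings_root cards1 -[2]mul1n leq_mul2r /=; apply/card_gt0P.
  exists (pblock P r); rewrite inE inP /=; apply/eqP; rewrite -siblings_root.
  by apply: topE; rewrite // /is_top memP eqxx.
apply: leq_sum => _ /andP[/imsetP[x _ ->] nxr].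
have {}nxr : x != r by apply: contraNneq nxr => ->.
rewrite mE; pose Ag := pblock P (parent x).
(* The siblings in the part of the parent form a clique with it. *)
have le1 : #|siblings x :&: Ag| <= 1.
  have := @spans_induced_clique _ Ag (parent x |: (siblings x :&: Ag)) (spansP _) _ _.
  rewrite cardsU1 inE negb_and parent_notin_siblings //=; apply.
    by rewrite subUset sub1set memP subsetIr.
  by apply: complete_sub (parent_siblings_complete nxr); apply: setUS; apply: subsetIl.
(* The other ones are tops of their parts, each taking at most two of them. *)
have le2 : #|siblings x :\: Ag| <= m (siblings x) * 2.
  rewrite -mE.
  apply: (@leq_trans (\sum_(A in P | siblings (top A) == siblings x) #|siblings x :&: A|)).
    rewrite -sum1_card.
    rewrite (partition_big (pblock P) (fun A => (A \in P) && (siblings (top A) == siblings x))) /=.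
      apply: leq_sum => A /andP[AP _]; rewrite sum1dep_card subset_leq_card //.
      by apply/subsetP=> y; rewrite !inE => /andP[/andP[_ ->] /eqP <-]; rewrite memP.
    move=> y /setDP[yx yNAg]; rewrite inP; apply/eqP; rewrite -(siblings_eq yx); apply: topE => //.
    rewrite /is_top memP (siblings_parent yx); apply/orP; right.
    by apply: contra yNAg => /(same_pblock trP); rewrite /Ag => ->.
  apply: leq_sum => A /andP[AP _]; apply: spans_induced_clique (Pind A AP) (subsetIr _ _) _.
  by apply: complete_sub (siblings_complete x); apply: subsetIl.
(* Parity improves the resulting bound #|siblings x| - 1 <= 2 m. *)
have := siblings_even nxr; have := cardsID Ag (siblings x).
by move: le1 le2; move: #|_| #|_| #|_| (m _); lia.
Qed.

End Rooted.

(** * The three implications *)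

Section Characterization.
Variable G : sgraph.

Lemma odd_blocks_indpp_extremal :
    connected [set: G] -> (forall B : {set G}, block B -> complete B /\ odd #|B|) ->
  indpp_extremal G.
Proof.
move=> Gc GB; have cB B : block B -> @complete G B by case/GB.
have GK := complete_blocks_locally_clique cB.
have odd_max B : B != set0 -> @complete G B ->
    (forall y, complete (y |: B) -> y \in B) -> odd #|B|.
  move=> B0 cliqueB maxB.
  (* A block containing the maximal clique B is complete, hence equal to B. *)
  have [B' mB' sBB'] := maxset_exists (complete_biconnected B0 cliqueB).
  have [cB' oB'] := GB B' mB'; suff -> : B = B' by [].
  apply/eqP; rewrite eqEsubset sBB'; apply/subsetP=> y yB'; apply: maxB.
  by apply: complete_sub cB'; rewrite subUset sub1set yB'.
have /card_gt0P[r _] := sgraph_nonnull G.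
have [d [d_root d_adj d_up]] := depth_exists (fun x => connected_connect r x Gc).
have npm := mate_near_perfect d_root d_adj d_up GK odd_max.
have [P PP cardP] := indpp_attained G.
have := induced_partition_lower d_root d_adj d_up GK odd_max PP.
have := pairing_le_matching npm.1; rewrite (near_perfect_holes npm) cards1 cardP.
have := indpp_le_ipp G; have := ipp_le_sub_matching G.
by rewrite /indpp_extremal; lia.
Qed.

Lemma indpp_extremal_ipp_extremal : indpp_extremal G -> ipp_extremal G.
Proof.
rewrite /indpp_extremal /ipp_extremal => indE; apply/eqP.
by rewrite eqn_leq ipp_le_sub_matching -indE indpp_le_ipp.
Qed.

Lemma ipp_extremal_odd_blocks :
    connected [set: G] -> odd #|G| -> ipp_extremal G ->
  forall B : {set G}, block B -> complete B /\ odd #|B|.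
Proof.
move=> Gc Godd ext B mB.
have [Gtri [f [h npf]]] := extremal_triangle_closed Gc Godd ext.
have np := near_perfect_hole_everywhere Gtri Gc npf.
have GK := near_perfect_locally_clique Gtri np.
have cB := locally_clique_biconnected GK (maxsetp mB).
by split=> //; apply: near_perfect_odd_block Gtri np mB cB.
Qed.

End Characterization.

Theorem corollary3p2 (G : sgraph) (Gconn : connected [set: G]) (Godd : odd #|G|) :
  (ipp_extremal G <-> indpp_extremal G) /\
  (indpp_extremal G <->
     forall B : {set G}, block B -> complete B /\ odd #|B|).
Proof.
have to_blocks := ipp_extremal_odd_blocks Gconn Godd.
have of_blocks := @odd_blocks_indpp_extremal G Gconn.
have to_ipp := @indpp_extremal_ipp_extremal G.
by split; split; auto.
Qed.
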